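(* Let $H$ be an $n$-stepsize matrix. For the first-order method with $H$ (unconstrained setting) and its corresponding co-coercivities $\{Q_{ij}\}$, assume that there exists $\lambda'=\{\lambda'_{ij}\ge0: i,j\in\{0,1,\dots,n\}\}$ such that $$\sum_{i,j}\lambda'_{ij}Q_{ij}=-\frac{R_n'}{2}\|g_n\|^2+f_0-f_n .$$ Then for the composite extension with $H$ and its corresponding co-coercivities $\{Q^f_{ij}\}$ and $\{Q^h_{ij}\}$, there exist $\mu'=\{\mu'_{ij}: i\in\{0,\dots,n\}, j\in\{1,\dots,n\}\}$ and $S'$, namely those given by the explicit formulas in the context, such that $$\sum_{i,j}\lambda'_{ij}Q^f_{ij}+\sum_{i,j}\mu'_{ij}Q^h_{ij}+\frac12\mathrm{Tr}\big(V'S'(V')^T\big)=-\frac{R_n'(1-\xi')}{2}\|g_n+s_n\|^2+F_0-F_n ,$$ where $V'=[\,g_n\,|\,s_1\,|\,\cdots\,|\,s_n\,]$ (concatenation of columns) and $F_i=f_i+h_i$. Furthermore, if (i) $\mu'_{ij}\ge0$ for all $i,j$, and (ii) $S'$ is positive semidefinite (e.g., implied if $\xi'=1-\frac{\lambda'_{n-1,n}+\lambda'_{n,n-1}}{R_n'}$), then the composite extension with $H$ has the following convergence guarantee: $$\|g_n+s_n\|^2\le\frac{2}{R_n'(1-\xi')}(F_0-F_n).$$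
   Context: Setting: $f$ is convex and $1$-smooth, $h$ is convex (possibly nonsmooth), $F=f+h$. For iterates $x_0,\dots,x_n$ write $f_i=f(x_i)$, $g_i=\nabla f(x_i)$, $h_i=h(x_i)$, $F_i=F(x_i)$, and let $s_i$ denote a subgradient of $h$ at $x_i$. $R_n'$ and $\xi'$ are real scalars; $\xi'$ is a parameter entering the definition of $S'$ below. Stepsize matrix: an $n$-stepsize matrix $H$ is an upper triangular $n\times n$ matrix whose entry in row $j+1$, column $i$ is $\alpha_{i,j}$ ($0\le j<i\le n$), with $\alpha_{k,k-1}\ne0$ for all $1\le k\le n$. First-order method with $H$ (unconstrained setting): $x_k=x_{k-1}-\sum_{j=0}^{k-1}\alpha_{k,j}g_j$ for $k=1,\dots,n$. Composite extension with $H$: $x_k=x_{k-1}-\sum_{j=0}^{k-1}\alpha_{k,j}(g_j+s_{j+1})$ for $k=1,\dots,n$. Co-coercivities: for the iterates of the first-order method with $H$, $Q_{ij}=f_i-f_j-\langle g_j,x_i-x_j\rangle-\frac12\|g_i-g_j\|^2$. For the iterates of the composite extension with $H$, $Q^f_{ij}=f_i-f_j-\langle g_j,x_i-x_j\rangle-\frac12\|g_i-g_j\|^2$ and $Q^h_{ij}=h_i-h_j-\langle s_j,x_i-x_j\rangle$. The two displayed equalities are algebraic identities: with the iterates expressed through the recursions above, both sides agree coefficient by coefficient as linear forms in the $f_i,h_i$ plus quadratic forms in the vectors $g_i,s_i$. Sums $\sum_{i,j}$ run over the index sets of the multipliers. Explicit formulas, with $\lambda'_{i,\bullet}=\sum_j\lambda'_{i,j}$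 and $\lambda'_{\bullet,j}=\sum_i\lambda'_{i,j}$: - $\widetilde H=HU_n$, where $U_n$ is the $n\times n$ upper triangular matrix with all entries on and above the diagonal equal to $1$. - $\widehat\lambda'\in\mathbb{R}^{n\times n}$, rows and columns indexed by $0,\dots,n-1$: off-diagonal $(i,j)$ entry $\lambda'_{i,j}+\lambda'_{j,i}$; diagonal $(i,i)$ entry $-(\lambda'_{\bullet,i}+\lambda'_{i,\bullet})$. - $\widetilde\lambda'\in\mathbb{R}^{n\times n}$, rows indexed by $i=1,\dots,n$, columns by $j=0,\dots,n-1$: entry $\lambda'_{i,j}$ if $i\ne j$, and $-\lambda'_{\bullet,i}$ if $i=j$. - $\widetilde\mu'=-\widetilde H^{-1}(\widetilde H\widetilde\lambda')^T\in\mathbb{R}^{n\times n}$. This determines $\mu'$: for $1\le i,j\le n$, $\mu'_{ij}=\widetilde\mu'_{ij}$ if $i\ne j$ and $\mu'_{ii}=0$; and $\mu'_{0,j}=-\sum_{i=1}^n\widetilde\mu'_{ij}$. - $v'=[v_1',\dots,v_n']$ with $v'_i=\lambda'_{i-1,n}+\lambda'_{n,i-1}$, and $$S'=\begin{bmatrix}R_n'&(v')^T\\ v'&-\widehat\lambda'\end{bmatrix}-R_n'(1-\xi')(e_1+e_{n+1})(e_1+e_{n+1})^T\in\mathbb{R}^{(n+1)\times(n+1)},$$ with $e_i$ the standard basis vectors of $\mathbb{R}^{n+1}$.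
   Formalization: The row and column totals of λ' omit the diagonal λ'_{ii} (with λ'_{00}>0 the literal formulas break the composite identity), and the convergence guarantee assumes ξ'<1 (at ξ'=1 it divides by zero, for ξ'>1 it fails). *)

(* Defs.v *)
From HB Require Import structures.
From mathcomp Require Import all_boot all_order all_algebra.
From mathcomp Require Import all_classical all_reals all_analysis.
Set Implicit Arguments.
Unset Strict Implicit.
Unset Printing Implicit Defensive.
Import Order.TTheory GRing.Theory Num.Theory.
Import numFieldNormedType.Exports.
Local Open Scope ring_scope.

Section Euclidean.
Variables (R : realType) (d : nat).
Implicit Types (u v x : 'cV[R]_d) (f : 'cV[R]_d -> R) (h : 'cV[R]_d -> \bar R).

Definition dot u v : R := (u^T *m v) 0 0.

(* The norm that the library puts on matrices is the sup norm. *)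
Definition enorm u : R := Num.sqrt (dot u u).

Definition gradient f x : 'cV[R]_d := \col_i 'D_(delta_mx i 0) f x.

Definition smooth (L : R) f : Prop :=
  (forall x, differentiable f x) /\
  (forall x y, enorm (gradient f x - gradient f y) <= L * enorm (x - y)).

(* A nonsmooth convex function may take the value +oo, so that constraints
   can be modelled; finite-valued functions are the special case EFin \o h. *)
Definition proper_convex h : Prop :=
  [/\ forall x, h x != -oo%E,
      exists x, h x != +oo%E
    & forall (x y : 'cV[R]_d) (t : R), 0 <= t <= 1 ->
        (h (t *: x + (1 - t) *: y)%R <= t%:E * h x + (1 - t)%R%:E * h y)%E].

Definition subgradient h x v : Prop :=
  forall y : 'cV[R]_d, (h x + (dot v (y - x)%R)%:E <= h y)%E.

Definition objective f h x : \bar R := ((f x)%:E + h x)%E.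

End Euclidean.

Definition psd (R : realType) m (S : 'M[R]_m) : Prop :=
  S^T = S /\ forall u : 'cV[R]_m, 0 <= dot u (S *m u).

Section Method.
Variables (R : realType) (n : nat).

(* The indices 0, ..., n-1 and 1, ..., n, inside 0, ..., n. *)
Definition lo (k : 'I_n) : 'I_n.+1 := widen_ord (leqnSn n) k.
Definition hi (k : 'I_n) : 'I_n.+1 := lift ord0 k.

(* With 0-based matrix indices, H j k is alpha_{k+1,j}. *)
Definition stepsize_matrix (H : 'M[R]_n) : Prop :=
  (forall i j : 'I_n, (j < i)%N -> H i j = 0) /\ (forall k, H k k != 0).

Section Iterates.
Variable d : nat.
Implicit Types (fv hv : 'I_n.+1 -> R) (g s x : 'I_n.+1 -> 'cV[R]_d).

Definition fom_iterates (H : 'M[R]_n) g x : Prop :=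
  forall k : 'I_n,
    x (hi k) = x (lo k) - \sum_(j < n | (j <= k)%N) H j k *: g (lo j).

(* The value s ord0 is never used. *)
Definition composite_iterates (H : 'M[R]_n) g s x : Prop :=
  forall k : 'I_n,
    x (hi k) = x (lo k)
      - \sum_(j < n | (j <= k)%N) H j k *: (g (lo j) + s (hi j)).

Definition Qf fv g x (i j : 'I_n.+1) : R :=
  fv i - fv j - dot (g j) (x i - x j) - 2^-1 * enorm (g i - g j) ^+ 2.

Definition Qh hv s x (i j : 'I_n.+1) : R :=
  hv i - hv j - dot (s j) (x i - x j).

Definition Vmx g s : 'M[R]_(d, 1 + n) :=
  row_mx (g ord_max) (\matrix_(i < d, j < n) s (hi j) i 0).

End Iterates.

Section Multipliers.
Variables (H : 'M[R]_n) (lam : 'M[R]_n.+1) (Rn xi : R).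

(* Multipliers lam i i are redundant, since Q_ii = 0; they are taken to be
   absent from the row and column sums, and occur nowhere else below. *)
Definition row_total (i : 'I_n.+1) : R := \sum_(j | j != i) lam i j.
Definition col_total (j : 'I_n.+1) : R := \sum_(i | i != j) lam i j.

Definition Htilde : 'M[R]_n := H *m \matrix_(i < n, j < n) (i <= j)%N%:R.

Definition lamhat : 'M[R]_n := \matrix_(i < n, j < n)
  if i == j then - (col_total (lo i) + row_total (lo i))
  else lam (lo i) (lo j) + lam (lo j) (lo i).

Definition lamtilde : 'M[R]_n := \matrix_(i < n, j < n)
  if hi i == lo j then - col_total (hi i) else lam (hi i) (lo j).

Definition mutilde : 'M[R]_n :=
  - (invmx Htilde *m (Htilde *m lamtilde)^T).

(* Rows are indexed by 0, ..., n and columns by 1, ..., n. *)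
Definition mu : 'M[R]_(n.+1, n) := \matrix_(i < n.+1, j < n)
  if unlift ord0 i is Some k then (if k == j then 0 else mutilde k j)
  else - \sum_(k < n) mutilde k j.

Definition vcol : 'cV[R]_n :=
  \col_i (lam (lo i) ord_max + lam ord_max (lo i)).

Definition Smx : 'M[R]_(1 + n) :=
  let e : 'cV[R]_(1 + n) := delta_mx ord0 0 + delta_mx ord_max 0 in
  block_mx Rn%:M vcol^T vcol (- lamhat) - (Rn * (1 - xi)) *: (e *m e^T).

End Multipliers.
End Method.

(* Main.v *)
Require Import Defs.
From HB Require Import structures.
From mathcomp Require Import all_boot all_order all_algebra.
From mathcomp Require Import all_classical all_reals all_analysis.
From mathcomp Require Import ring lra.
Set Implicit Arguments.
Unset Strict Implicit.
Unset Printing Implicit Defensive.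
Import Order.TTheory GRing.Theory Num.Theory.
Import numFieldNormedType.Exports.
Local Open Scope ring_scope.

(* With G_j = g_j + s_{j+1} for j < n, the composite iterates are the iterates of
   the first-order method driven by G, so x_0 - x_k = sum_j Htilde_{j,k} G_j in both
   settings. Put M = Htilde * lamtilde. Comparing coefficients in the identity of
   the first-order method (dimension 1 suffices) gives M + M^T = - lamhat,
   M^T 1 = Htilde e_n, Htilde * lamtilde_last = - v', and
   R_n' = sum_i (lam_{i,n} + lam_{n,i}) >= 1. Since Htilde * mutilde = - M^T, the
   cross terms between g and s cancel in the composite sum, and what is left is
   minus half the quadratic form of S'. For the special xi' that form, with the
   sign of its first variable flipped, is the weighted Laplacian form
   sum_{i,j} lam_{i,j} (z_i - z_j)^2 without the edge {n-1, n}. The rate follows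
   since all co-coercivities are nonnegative; when h(x_0) = +oo its right-hand side is +oo. *)

Lemma lo_lift n (i : 'I_n) : lo i = lift ord_max i.
Proof. by apply: val_inj; rewrite [RHS]lift_max. Qed.

Lemma lo_neq_max n (i : 'I_n) : (lo i == ord_max) = false.
Proof. by rewrite lo_lift eq_sym; apply/negbTE/neq_lift. Qed.

(** * Euclidean inner product *)

Section Dot.
Variables (R : realType) (d : nat).
Implicit Types u v w : 'cV[R]_d.

Lemma dotE u v : dot u v = \sum_i u i 0 * v i 0.
Proof. by rewrite /dot mxE; apply: eq_bigr => i _; rewrite mxE. Qed.

Lemma dotC u v : dot u v = dot v u.
Proof. by rewrite !dotE; apply: eq_bigr => i _; rewrite mulrC. Qed.

Lemma dotDr u v w : dot u (v + w) = dot u v + dot u w.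
Proof. by rewrite /dot mulmxDr mxE. Qed.

Lemma dotNr u v : dot u (- v) = - dot u v.
Proof. by rewrite /dot mulmxN mxE. Qed.

Lemma dotBr u v w : dot u (v - w) = dot u v - dot u w.
Proof. by rewrite dotDr dotNr. Qed.

Lemma dotZr a u v : dot u (a *: v) = a * dot u v.
Proof. by rewrite /dot -scalemxAr mxE. Qed.

Lemma dotBl u v w : dot (v - w) u = dot v u - dot w u.
Proof. by rewrite dotC dotBr !(dotC u). Qed.

Lemma dotZl a u v : dot (a *: v) u = a * dot v u.
Proof. by rewrite dotC dotZr dotC. Qed.

Lemma dot0r u : dot u 0 = 0.
Proof. by rewrite /dot mulmx0 mxE. Qed.

Lemma dot_sumr (I : finType) u (F : I -> 'cV[R]_d) :
  dot u (\sum_i F i) = \sum_i dot u (F i).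
Proof. by rewrite /dot mulmx_sumr summxE. Qed.

Lemma dot_suml (I : finType) u (F : I -> 'cV[R]_d) :
  dot (\sum_i F i) u = \sum_i dot (F i) u.
Proof. by rewrite dotC dot_sumr; apply: eq_bigr => i _; rewrite dotC. Qed.

Lemma dot_ge0 u : 0 <= dot u u.
Proof. by rewrite dotE sumr_ge0 // => i _; rewrite -expr2 sqr_ge0. Qed.

Lemma enorm_sqr u : enorm u ^+ 2 = dot u u.
Proof. by rewrite sqr_sqrtr ?dot_ge0. Qed.

Lemma mxtrace_dot u v : \tr (u *m v^T) = dot u v.
Proof. by rewrite mxtrace_mulC trace_mx11 -/(dot v u) dotC. Qed.

Lemma dot_polarization u v :
  dot (u - v) (u - v) = dot u u + dot v v - 2 * dot u v.
Proof. by rewrite dotBl !dotBr (dotC v u); ring. Qed.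

End Dot.

(** * Families of vectors as matrices, and their trace forms *)

Section Family.
Variables (R : realType) (d : nat).

(** The vectors are the columns, so coefficient matrices act on the right and bilinear forms in two
    families become traces. *)
Definition fam_mx m (a : 'I_m -> 'cV[R]_d) : 'M[R]_(d, m) :=
  \matrix_(l, i) a i l 0.

Lemma fam_mxD m (a b : 'I_m -> 'cV[R]_d) :
  fam_mx (fun i => a i + b i) = fam_mx a + fam_mx b.
Proof. by apply/matrixP => i j; rewrite !mxE. Qed.

Lemma fam_mx_mul m p (a : 'I_m -> 'cV[R]_d) (L : 'M[R]_(m, p)) :
  fam_mx a *m L = fam_mx (fun j => \sum_i L i j *: a i).
Proof.
apply/matrixP => l j; rewrite !mxE summxE; apply: eq_bigr => i _.
by rewrite !mxE mulrC.
Qed.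

Lemma fam_mx_mulv m (a : 'I_m -> 'cV[R]_d) (v : 'cV[R]_m) :
  fam_mx a *m v = \sum_i v i 0 *: a i.
Proof. by rewrite fam_mx_mul; apply/matrixP => l j; rewrite !mxE ord1. Qed.

Lemma mxtrace_fam m p (a : 'I_m -> 'cV[R]_d) (b : 'I_p -> 'cV[R]_d) L :
  \tr (fam_mx a *m L *m (fam_mx b)^T) = \sum_i \sum_j L i j * dot (a i) (b j).
Proof.
rewrite exchange_big /= fam_mx_mul /mxtrace.
under [LHS]eq_bigr => l _ do rewrite mxE.
rewrite exchange_big /=; apply: eq_bigr => j _.
under [RHS]eq_bigr => i _ do rewrite -dotZl.
rewrite -dot_suml dotE; apply: eq_bigr => l _.
by rewrite !mxE.
Qed.

Lemma eq_fam_mx m (a b : 'I_m -> 'cV[R]_d) : a =1 b -> fam_mx a = fam_mx b.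
Proof. by move=> e; apply/matrixP => i j; rewrite !mxE e. Qed.

Lemma mxtrace_form_tr m (X Y : 'M[R]_(d, m)) (L : 'M[R]_m) :
  \tr (X *m L^T *m Y^T) = \tr (Y *m L *m X^T).
Proof. by rewrite -mxtrace_tr !trmx_mul !trmxK mulmxA. Qed.

End Family.

(** * Expansion of weighted co-coercivity sums *)

Section Laplacian.
Variables (R : realType) (n d : nat) (lam : 'M[R]_n.+1).
Implicit Types g x z : 'I_n.+1 -> 'cV[R]_d.

(** Diagonal multipliers only ever meet terms that vanish; removing them turns the totals into
    unrestricted sums, which can be exchanged. *)
Let off i j := if i == j then 0 else lam i j.

Let row_off i : row_total lam i = \sum_j off i j.
Proof.
by rewrite /row_total big_mkcond /=; apply: eq_bigr => j _; rewrite /off eq_sym; case: eqP.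
Qed.

Let col_off j : col_total lam j = \sum_i off i j.
Proof.
by rewrite /col_total big_mkcond /=; apply: eq_bigr => i _; rewrite /off; case: eqP.
Qed.

Let sum_off (F : 'I_n.+1 -> 'I_n.+1 -> R) : (forall i, F i i = 0) ->
  \sum_i \sum_j lam i j * F i j = \sum_i \sum_j off i j * F i j.
Proof.
move=> F0; apply: eq_bigr => i _; apply: eq_bigr => j _.
by rewrite /off; case: eqP => // ->; rewrite F0 !mulr0.
Qed.

Let sum_diag (c : 'I_n.+1 -> R) (F : 'I_n.+1 -> 'I_n.+1 -> R) :
  \sum_i \sum_j ((i == j)%:R * c j) * F i j = \sum_i c i * F i i.
Proof.
apply: eq_bigr => i _; rewrite (bigD1 i) //= eqxx mul1r big1 ?addr0 // => j.
by rewrite eq_sym => /negPf ->; rewrite !mul0r.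
Qed.

Lemma sum_total (c : 'I_n.+1 -> R) :
  \sum_i \sum_j lam i j * (c i - c j) =
  \sum_i (row_total lam i - col_total lam i) * c i.
Proof.
rewrite (sum_off (F := fun i j => c i - c j)); last by move=> i; rewrite subrr.
under [RHS]eq_bigr => i _ do rewrite row_off col_off mulrBl !mulr_suml.
rewrite sumrB [X in _ = _ - X]exchange_big /= -sumrB; apply: eq_bigr => i _.
by rewrite -sumrB; apply: eq_bigr => j _; rewrite mulrBr.
Qed.

Lemma lamhat_sym : (lamhat lam)^T = lamhat lam.
Proof.
by apply/matrixP => i j; rewrite !mxE eq_sym; case: eqP => [->|_] //; rewrite addrC.
Qed.

(** Expanding the squares gives the Laplacian [K] of the graph with edge weights lam_ij + lam_ji.
    Splitting off index n leaves a corner entry, the border [- vcol] and the block [- lamhat]. This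
    serves both the gradient terms of the co-coercivities and the positivity of S'. *)
Lemma laplacian_form z :
  \sum_i \sum_j lam i j * dot (z i - z j) (z i - z j) =
  (row_total lam ord_max + col_total lam ord_max) * dot (z ord_max) (z ord_max)
  - 2 * dot (z ord_max) (fam_mx (z \o @lo n) *m vcol lam)
  - \tr (fam_mx (z \o @lo n) *m lamhat lam *m (fam_mx (z \o @lo n))^T).
Proof.
pose K (i j : 'I_n.+1) :=
  (i == j)%:R * (row_total lam j + col_total lam j) - (off i j + off j i).
transitivity (\sum_i \sum_j K i j * dot (z i) (z j)).
  rewrite (sum_off (F := fun i j => dot (z i - z j) (z i - z j))); last first.
    by move=> i; rewrite subrr dot0r.
  rewrite /K; under [RHS]eq_bigr => i _ do under eq_bigr => j _ do rewrite mulrBl.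
  under [RHS]eq_bigr => i _ do rewrite sumrB.
  rewrite sumrB (sum_diag (fun i => row_total lam i + col_total lam i)
    (fun i j => dot (z i) (z j))).
  under [X in _ = X - _]eq_bigr => i _ do rewrite row_off col_off mulrDl !mulr_suml.
  rewrite big_split /= [X in _ = _ + X - _]exchange_big /= -big_split /=.
  have -> : \sum_i \sum_j (off i j + off j i) * dot (z i) (z j) =
      2 * \sum_i \sum_j off i j * dot (z i) (z j).
    under eq_bigr => i _ do under eq_bigr => j _ do rewrite mulrDl.
    under eq_bigr => i _ do rewrite big_split /=.
    rewrite big_split /= [X in _ + X]exchange_big /= mulr2n mulrDl mul1r.
    congr (_ + _); apply: eq_bigr => i _; apply: eq_bigr => j _.
    by rewrite dotC.
  rewrite mulr_sumr -sumrB; apply: eq_bigr => i _.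
  rewrite -big_split /= mulr_sumr -sumrB; apply: eq_bigr => j _.
  by rewrite dot_polarization; ring.
rewrite mxtrace_fam fam_mx_mulv dot_sumr.
rewrite [LHS]big_ord_recr /=.
under eq_bigr => i _ do rewrite big_ord_recr /=.
rewrite big_split /= [X in _ + X]big_ord_recr /=.
have -> : K ord_max ord_max = row_total lam ord_max + col_total lam ord_max.
  by rewrite /K /off !eqxx /=; ring.
have -> : \sum_(i < n) \sum_(j < n) K (lo i) (lo j) * dot (z (lo i)) (z (lo j)) =
   - \sum_i \sum_j lamhat lam i j * dot ((z \o @lo n) i) ((z \o @lo n) j).
  rewrite -sumrN; apply: eq_bigr => i _; rewrite -sumrN; apply: eq_bigr => j _.
  rewrite /K /off !mxE (eq_sym (lo j)) -[lo i == lo j]/(i == j).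
  by have [->|_] := eqVneq i j => /=; ring.
have kv (i : 'I_n) : K (lo i) ord_max = - vcol lam i 0.
  by rewrite /K /off !mxE (eq_sym ord_max) !lo_neq_max /=; ring.
have vk (i : 'I_n) : K ord_max (lo i) = - vcol lam i 0.
  by rewrite /K /off !mxE (eq_sym ord_max) !lo_neq_max /=; ring.
have -> : \sum_(i < n) K (lo i) ord_max * dot (z (lo i)) (z ord_max) =
   - \sum_i dot (z ord_max) (vcol lam i 0 *: (z \o @lo n) i).
  by rewrite -sumrN; apply: eq_bigr => i _; rewrite kv dotZr dotC mulNr.
have -> : \sum_(i < n) K ord_max (lo i) * dot (z ord_max) (z (lo i)) =
   - \sum_i dot (z ord_max) (vcol lam i 0 *: (z \o @lo n) i).
  by rewrite -sumrN; apply: eq_bigr => i _; rewrite vk dotZr mulNr.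
by ring.
Qed.

(** The column that continues the pattern of [lamtilde] to j = n. *)
Definition lamtilde_last : 'cV[R]_n := \col_i
  if hi i == ord_max then - col_total lam ord_max else lam (hi i) ord_max.

(** With y_i = x_0 - x_i each term is lam_ij <g_j, y_i - y_j>, so [P] collects the coefficients of
    <y_i, g_j>. Row 0 drops out because y_0 = 0, and column n is kept apart. *)
Lemma cross_form g x :
  - \sum_i \sum_j lam i j * dot (g j) (x i - x j) =
  \tr (fam_mx (fun k => x ord0 - x (hi k)) *m lamtilde lam *m (fam_mx (g \o @lo n))^T)
  + dot (g ord_max) (fam_mx (fun k => x ord0 - x (hi k)) *m lamtilde_last).
Proof.
pose y i := x ord0 - x i.
pose P (i j : 'I_n.+1) := off i j - (i == j)%:R * col_total lam j.
transitivity (\sum_i \sum_j P i j * dot (y i) (g j)).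
  rewrite (sum_off (F := fun i j => dot (g j) (x i - x j))); last first.
    by move=> i; rewrite subrr dot0r.
  rewrite /P; under [RHS]eq_bigr => i _ do under eq_bigr => j _ do rewrite mulrBl.
  under [RHS]eq_bigr => i _ do rewrite sumrB.
  rewrite sumrB (sum_diag (fun i => col_total lam i) (fun i j => dot (y i) (g j))).
  under [X in _ = _ - X]eq_bigr => i _ do rewrite col_off !mulr_suml.
  rewrite [X in _ = _ - X]exchange_big /= -sumrN -sumrB; apply: eq_bigr => i _.
  rewrite -sumrN -sumrB; apply: eq_bigr => j _.
  by rewrite /y !dotBl dotBr (dotC (x i)) (dotC (x j)); ring.
rewrite big_ord_recl /= big1 ?add0r => [|j _]; last first.
  by rewrite /y subrr dotC dot0r mulr0.
rewrite mxtrace_fam fam_mx_mulv dot_sumr -big_split /=; apply: eq_bigr => i _.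
rewrite big_ord_recr /=; congr (_ + _).
  apply: eq_bigr => j _; rewrite /P /off !mxE -/(hi i) -/(lo j) /y.
  by case: eqP => [->|_] /=; ring.
rewrite /P /off dotZr !mxE -/(hi i) /y (dotC (g _)).
by case: eqP => [->|_] /=; ring.
Qed.

(** The points and the gradients are still unrelated here, so the expansion applies to the
    first-order method and to the composite extension alike. *)
Lemma sum_Qf fv g x :
  \sum_i \sum_j lam i j * Qf fv g x i j =
  \sum_i (row_total lam i - col_total lam i) * fv i
  + \tr (fam_mx (fun k => x ord0 - x (hi k)) *m lamtilde lam *m (fam_mx (g \o @lo n))^T)
  + dot (g ord_max) (fam_mx (fun k => x ord0 - x (hi k)) *m lamtilde_last)
  + 2^-1 * \tr (fam_mx (g \o @lo n) *m lamhat lam *m (fam_mx (g \o @lo n))^T)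
  + dot (g ord_max) (fam_mx (g \o @lo n) *m vcol lam)
  - 2^-1 * (row_total lam ord_max + col_total lam ord_max) * dot (g ord_max) (g ord_max).
Proof.
have -> : \sum_i \sum_j lam i j * Qf fv g x i j =
   \sum_i \sum_j lam i j * (fv i - fv j)
   - \sum_i \sum_j lam i j * dot (g j) (x i - x j)
   - 2^-1 * \sum_i \sum_j lam i j * dot (g i - g j) (g i - g j).
  rewrite mulr_sumr -sumrB -sumrB; apply: eq_bigr => i _.
  rewrite mulr_sumr -sumrB -sumrB; apply: eq_bigr => j _.
  by rewrite /Qf enorm_sqr; ring.
by rewrite sum_total cross_form laplacian_form; field.
Qed.

End Laplacian.

(** * Iterates as linear images of the driving vectors *)

Section Iterates.
Variables (R : realType) (n d : nat) (H : 'M[R]_n).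
Implicit Types (a : 'I_n -> 'cV[R]_d) (x : 'I_n.+1 -> 'cV[R]_d).

Lemma big_lt_hi (F : 'I_n -> 'cV[R]_d) (k : 'I_n) :
  \sum_(i < n | (i < hi k)%N) F i = F k + \sum_(i < n | (i < lo k)%N) F i.
Proof.
rewrite (bigD1 k) ?ltnSn //=; congr (_ + _); apply: eq_bigl => i.
by rewrite /bump /= add1n ltnS andbC -val_eqE -ltn_neqAle.
Qed.

(** Every driving sequence is realised, starting from x_0 = 0; hence the gradients are free
    variables when coefficients are compared. *)
Lemma iterates_exist a : exists x, forall k : 'I_n,
  x (hi k) = x (lo k) - \sum_(j < n | (j <= k)%N) H j k *: a j.
Proof.
exists (fun i => - \sum_(k < n | (k < i)%N) \sum_(j < n | (j <= k)%N) H j k *: a j).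
by move=> k; rewrite big_lt_hi opprD addrC.
Qed.

(** Step k subtracts the combination of the a_j given by column k of [H]; telescoping the steps is
    multiplication by the triangular matrix of ones in [Htilde]. *)
Lemma iterates_span a x : stepsize_matrix H ->
  (forall k : 'I_n, x (hi k) = x (lo k) - \sum_(j < n | (j <= k)%N) H j k *: a j) ->
  fam_mx (fun k => x ord0 - x (hi k)) = fam_mx a *m Htilde H.
Proof.
move=> [H_upper _] xE.
have x_sum m (i : 'I_n.+1) : i = m :> nat ->
    x ord0 - x i = \sum_(k < n | (k < i)%N) \sum_j H j k *: a j.
  elim: m i => [|m IHm] i im.
    have -> : i = ord0 by apply: val_inj.
    by rewrite subrr big_pred0.
  have mn : (m < n)%N by have := ltn_ord i; rewrite im ltnS.
  have -> : i = hi (Ordinal mn) by apply: val_inj => /=; rewrite im.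
  rewrite big_lt_hi -IHm // xE opprB addrCA; congr (_ + _).
  rewrite big_mkcond /=; apply: eq_bigr => j _; case: leqP => // mj.
  by rewrite H_upper ?scale0r.
rewrite /Htilde mulmxA !fam_mx_mul; apply: eq_fam_mx => k.
rewrite (x_sum (hi k)) // big_mkcond /=; apply: eq_bigr => i _.
rewrite mxE /bump /= add1n ltnS.
by case: leqP => _; rewrite ?scale1r ?scale0r.
Qed.

End Iterates.

(** Both factors are upper triangular with nonzero diagonals. *)
Lemma Htilde_unit (R : realType) (n : nat) (H : 'M[R]_n) :
  stepsize_matrix H -> Htilde H \in unitmx.
Proof.
move=> [H_upper H_diag]; rewrite unitmxE /Htilde det_mulmx unitfE mulf_neq0 //.
  rewrite -det_tr det_trig; last by apply/is_trig_mxP => i j ij; rewrite mxE H_upper.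
  by apply/prodf_neq0 => i _; rewrite mxE.
rewrite -det_tr det_trig; last first.
  by apply/is_trig_mxP => i j ij; rewrite !mxE leqNgt ij.
by apply/prodf_neq0 => i _; rewrite !mxE leqnn oner_neq0.
Qed.

(** Polarization: evaluating at the sum of two unit row vectors leaves B_ij + B_ji. *)
Lemma tr_form_eq0 (R : realType) (n : nat) (B : 'M[R]_n) :
  (forall u : 'rV[R]_n, \tr (u *m B *m u^T) = 0) -> B^T = - B.
Proof.
move=> B0; apply/matrixP => i j; rewrite !mxE.
have := B0 (delta_mx 0 i + delta_mx 0 j).
rewrite linearD /= !mulmxDl !mulmxDr !mxtraceD !B0 add0r addr0.
rewrite -!rowE !trmx_delta -!colE !trace_mx11 !mxE => /eqP.
by rewrite addrC addr_eq0 => /eqP.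
Qed.

(** * Coefficient comparison in the first-order identity *)

Section CoefficientIdentities.
Variables (R : realType) (n : nat) (H : 'M[R]_n) (lam : 'M[R]_n.+1) (Rn : R).
Hypothesis H_step : stepsize_matrix H.
Hypothesis fom_identity : forall (d : nat) (fv : 'I_n.+1 -> R)
    (g x : 'I_n.+1 -> 'cV[R]_d),
  fom_iterates H g x ->
  \sum_i \sum_j lam i j * Qf fv g x i j
    = - (Rn / 2) * enorm (g ord_max) ^+ 2 + fv ord0 - fv ord_max.

(** In dimension 0 all inner products vanish and only the function values remain. *)
Lemma total_sum (fv : 'I_n.+1 -> R) :
  \sum_i (row_total lam i - col_total lam i) * fv i = fv ord0 - fv ord_max.
Proof.
rewrite -sum_total.
have /(fom_identity fv) : fom_iterates (d := 0) H (fun=> 0) (fun=> 0).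
  by move=> k; apply/matrixP => - [].
rewrite enorm_sqr dot0r mulr0 add0r => <-.
apply: eq_bigr => i _; apply: eq_bigr => j _.
by rewrite /Qf enorm_sqr subrr !dot0r mulr0 !subr0.
Qed.

Lemma total_diff (i : 'I_n.+1) :
  row_total lam i - col_total lam i = (i == ord0)%:R - (i == ord_max)%:R.
Proof.
have := total_sum (fun j => (i == j)%:R); rewrite (bigD1 i) //= eqxx mulr1.
rewrite big1 ?addr0 // => j; rewrite eq_sym => /negPf ->.
by rewrite mulr0.
Qed.

Let M := Htilde H *m lamtilde lam.

(** The identity in dimension 1 with zero function values: the entries of [u] serve as g_0, ...,
    g_{n-1} and [c] as g_n, all arbitrary by [iterates_exist]. *)
Lemma fom_quadratic (u : 'rV[R]_n) (c : 'cV[R]_1) :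
  \tr (u *m M *m u^T) + dot c (u *m Htilde H *m lamtilde_last lam)
  + 2^-1 * \tr (u *m lamhat lam *m u^T) + dot c (u *m vcol lam)
  - 2^-1 * (row_total lam ord_max + col_total lam ord_max) * dot c c
  = - (Rn / 2) * dot c c.
Proof.
pose a (k : 'I_n) : 'cV[R]_1 := col k u.
have aE : fam_mx a = u by apply/matrixP => i j; rewrite !mxE ord1.
pose g (i : 'I_n.+1) := if unlift ord_max i is Some k then a k else c.
have g_lo k : g (lo k) = a k by rewrite lo_lift /g liftK.
have g_max : g ord_max = c by rewrite /g unlift_none.
have [x xE] := iterates_exist H a.
have fomx : fom_iterates H g x.
  by move=> k; rewrite xE; congr (_ - _); apply: eq_bigr => j _; rewrite g_lo.
have := fom_identity (fun=> 0) fomx.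
rewrite sum_Qf g_max enorm_sqr (iterates_span H_step xE).
rewrite (eq_fam_mx (b := a)) // aE subr0 addr0 => <-.
by rewrite big1 ?add0r => [|i _]; rewrite ?mulr0 // /M !mulmxA.
Qed.

Lemma RnE : Rn = row_total lam ord_max + col_total lam ord_max.
Proof.
have := fom_quadratic 0 1.
rewrite !mul0mx !dot0r mxtrace0 mulr0 !add0r -mulNr.
have -> : dot (1 : 'cV[R]_1) 1 = 1 by rewrite dotE big_ord1 !mxE mulr1.
by lra.
Qed.

(** Taking g_n = 0 shows that the quadratic form of M + lamhat / 2 vanishes, so this matrix is skew;
    [lamhat] is symmetric. *)
Lemma M_antisym : M + M^T = - lamhat lam.
Proof.
have : (M + 2^-1 *: lamhat lam)^T = - (M + 2^-1 *: lamhat lam).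
  apply: tr_form_eq0 => u; have := fom_quadratic u 0.
  rewrite mulmxDr mulmxDl mxtraceD -scalemxAr -scalemxAl mxtraceZ.
  by rewrite dot0r !(dotC 0) !dot0r !mulr0 subr0 !addr0.
rewrite linearD /= linearZ /= lamhat_sym => e.
have -> : M + M^T = M + (M^T + 2^-1 *: lamhat lam) - 2^-1 *: lamhat lam.
  by rewrite addrA addrK.
rewrite e opprD addrA subrr sub0r -opprD -scalerDl.
by rewrite -[RHS]scaleN1r -scaleNr; congr (_ *: _); lra.
Qed.

(** This is the coefficient of the product of g_i and g_n, isolated by subtracting the form at c = 0
    from the form at c = 1. *)
Lemma Htilde_lamtilde_last : Htilde H *m lamtilde_last lam = - vcol lam.
Proof.
apply/eqP; rewrite -addr_eq0; apply/eqP/matrixP => i j.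
rewrite [RHS]mxE; pose u : 'rV[R]_n := delta_mx 0 i.
have := fom_quadratic u 1; have := fom_quadratic u 0.
rewrite -RnE !dot0r !(dotC 0) !dot0r !mulr0 subr0 !addr0 => form0.
have dot1 (w : 'cV[R]_1) : dot 1 w = w 0 0 by rewrite dotE big_ord1 mxE mul1r.
rewrite !dot1 -(mulmxA u (Htilde H)) -(rowE i (_ *m _ : 'cV_n)) -(rowE i (vcol lam)) => form1.
have -> : j = 0 by rewrite ord1.
have row0 (w : 'cV[R]_n) : row i w 0 0 = w i 0 by rewrite mxE.
by move: form0 form1; rewrite [X in _ -> _ -> X = _]mxE !row0; lra.
Qed.

Let ones : 'cV[R]_n := const_mx 1.
Let e_last : 'cV[R]_n := \col_i (hi i == ord_max)%:R.

(** Row i of [lamtilde] extended by [lamtilde_last] sums to the row total minus the column total at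
    index i + 1, which [total_diff] evaluates. *)
Lemma lamtilde_ones : lamtilde lam *m ones = - lamtilde_last lam - e_last.
Proof.
apply/matrixP => i j; rewrite !mxE.
under eq_bigr => k _ do rewrite mxE [ones k j]mxE mulr1.
have := total_diff (hi i); rewrite sub0r => diff.
have : \sum_(k < n.+1) (if hi i == k then - col_total lam (hi i) else lam (hi i) k)
    = row_total lam (hi i) - col_total lam (hi i).
  rewrite (bigD1 (hi i)) //= eqxx addrC; congr (_ - _); apply: eq_bigr => k.
  by rewrite eq_sym => /negPf ->.
rewrite diff big_ord_recr /= => /(canRL (addrK _)) ->.
by rewrite addrC; congr (- _ - _); case: eqP => // ->.
Qed.

(** The rows of a Laplacian sum to zero, and [vcol] supplies the missing column n. *)
Lemma lamhat_ones : lamhat lam *m ones = - vcol lam.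
Proof.
apply/matrixP => i j; rewrite !mxE.
under eq_bigr => k _ do rewrite mxE [ones k j]mxE mulr1.
have : \sum_(k < n.+1) (if lo i == k then - (col_total lam (lo i) + row_total lam (lo i))
    else lam (lo i) k + lam k (lo i)) = 0.
  rewrite (bigD1 (lo i)) //= eqxx addrC; apply/eqP; rewrite subr_eq0 addrC; apply/eqP.
  rewrite -big_split /=; apply: eq_bigr => k.
  by rewrite eq_sym addrC => /negPf ->.
rewrite big_ord_recr /= => /eqP; rewrite addr_eq0 => /eqP.
rewrite lo_neq_max.
by move=> <-; apply: eq_bigr => k _.
Qed.

Lemma M_tr_ones : M^T *m ones = Htilde H *m e_last.
Proof.
have -> : M^T = - lamhat lam - M by rewrite -M_antisym addrAC subrr add0r.
rewrite mulmxBl mulNmx lamhat_ones opprK /M -mulmxA lamtilde_ones.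
by rewrite mulmxBr mulmxN Htilde_lamtilde_last opprK opprB addrC subrK.
Qed.

Lemma Htilde_mutilde : Htilde H *m mutilde H lam = - M^T.
Proof. by rewrite /mutilde mulmxN mulmxA mulmxV ?mul1mx ?Htilde_unit. Qed.

(** These row sums are the coefficients of h_k - h_0 in the nonsmooth sum, so only h_0 - h_n
    survives there. *)
Lemma mutilde_ones : mutilde H lam *m ones = - e_last.
Proof.
by rewrite /mutilde mulNmx -mulmxA M_tr_ones mulmxA mulVmx ?mul1mx ?Htilde_unit.
Qed.

(** The diagonal zeroed in [mu] meets a zero difference. With [mutilde] restored there, row 0 makes
    each column sum to zero, so the reference value moves from index [hi j] to index 0. *)
Lemma sum_mu (c : 'I_n.+1 -> 'I_n -> R) :
  \sum_(i < n.+1) \sum_(j < n) mu H lam i j * (c i j - c (hi j) j)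
  = \sum_(k < n) \sum_(j < n) mutilde H lam k j * (c (hi k) j - c ord0 j).
Proof.
rewrite exchange_big [RHS]exchange_big /=; apply: eq_bigr => j _.
have mu0 : mu H lam ord0 j = - \sum_(k < n) mutilde H lam k j.
  by rewrite /mu [LHS]mxE unlift_none.
have mu_hi k : mu H lam (hi k) j = if k == j then 0 else mutilde H lam k j.
  by rewrite /mu [LHS]mxE liftK.
rewrite big_ord_recl mu0 mulNr mulr_suml -sumrN -big_split /=.
apply: eq_bigr => k _; rewrite mu_hi.
by case: eqP => [->|_]; ring.
Qed.

(** * The composite identity *)

Section Composite.
Variables (d : nat) (fv hv : 'I_n.+1 -> R) (g s x : 'I_n.+1 -> 'cV[R]_d).
Hypothesis x_iterates : composite_iterates H g s x.

Let X := fam_mx (g \o @lo n).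
Let S := fam_mx (s \o @hi n).

Let Y_E : fam_mx (fun k => x ord0 - x (hi k)) = (X + S) *m Htilde H.
Proof. by rewrite (iterates_span H_step x_iterates) fam_mxD. Qed.

(** Column n of the cross terms contributes - (X + S) v' against g_n; its X part cancels the X v'
    coming from the squared gradient differences. *)
Lemma composite_sum_Qf :
  \sum_i \sum_j lam i j * Qf fv g x i j =
  fv ord0 - fv ord_max + \tr ((X + S) *m M *m X^T)
  - dot (g ord_max) (S *m vcol lam)
  + 2^-1 * \tr (X *m lamhat lam *m X^T) - 2^-1 * Rn * dot (g ord_max) (g ord_max).
Proof.
rewrite sum_Qf total_sum Y_E -RnE -/X -(mulmxA (X + S) (Htilde H) (lamtilde_last lam)).
rewrite Htilde_lamtilde_last.
rewrite mulmxN (mulmxDl X S (vcol lam)) dotNr dotDr /M !mulmxA; ring.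
Qed.

Lemma composite_sum_Qh :
  \sum_(i < n.+1) \sum_(j < n) mu H lam i j * Qh hv s x i (hi j) =
  hv ord0 - hv ord_max - \tr ((X + S) *m M^T *m S^T).
Proof.
(* In this form each [Qh] term is a difference within one column, as [sum_mu] requires. *)
pose c (i : 'I_n.+1) (j : 'I_n) := hv i - dot (s (hi j)) (x i).
under eq_bigr => i _ do under eq_bigr => j _ do
  have -> : Qh hv s x i (hi j) = c i j - c (hi j) j by rewrite /Qh /c dotBr; ring.
rewrite sum_mu.
have -> : - \tr ((X + S) *m M^T *m S^T)
    = \tr (fam_mx (fun k => x ord0 - x (hi k)) *m mutilde H lam *m S^T).
  by rewrite Y_E -(mulmxA (X + S) (Htilde H)) Htilde_mutilde mulmxN mulNmx linearN.
rewrite mxtrace_fam.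
have -> : hv ord0 - hv ord_max
    = \sum_(k < n) (mutilde H lam *m ones) k 0 * (hv (hi k) - hv ord0).
  rewrite mutilde_ones.
  have : \sum_(k < n.+1) (k == ord_max)%:R * (hv k - hv ord0) = hv ord_max - hv ord0.
    rewrite (bigD1 ord_max) //= eqxx mul1r big1 ?addr0 // => k /negPf ->.
    by rewrite mul0r.
  rewrite big_ord_recl /= subrr mulr0 add0r => diff; rewrite -[LHS]opprB -diff.
  by rewrite -sumrN; apply: eq_bigr => k _; rewrite !mxE mulNr.
rewrite -big_split /=; apply: eq_bigr => k _.
rewrite mxE mulr_suml -big_split /=; apply: eq_bigr => j _.
by rewrite [ones j 0]mxE mulr1 /c dotBl !(dotC (s _)); ring.
Qed.

(** The mixed traces of S M X^T and X M^T S^T are equal and cancel. By [skew] the terms in X alone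
    cancel as well, and those in S alone leave half the form of [lamhat]. *)
Lemma composite_identity :
  \sum_i \sum_j lam i j * Qf fv g x i j
  + \sum_(i < n.+1) \sum_(j < n) mu H lam i j * Qh hv s x i (hi j) =
  fv ord0 + hv ord0 - (fv ord_max + hv ord_max)
  - 2^-1 * (Rn * dot (g ord_max) (g ord_max)
    + 2 * dot (g ord_max) (S *m vcol lam) - \tr (S *m lamhat lam *m S^T)).
Proof.
have skew (Z : 'M[R]_(d, n)) :
    \tr (Z *m lamhat lam *m Z^T) = - 2 * \tr (Z *m M *m Z^T).
  have -> : lamhat lam = - (M + M^T) by rewrite M_antisym opprK.
  rewrite mulmxN mulNmx linearN /= mulmxDr mulmxDl mxtraceD mxtrace_form_tr; ring.
rewrite composite_sum_Qf composite_sum_Qh !skew !mulmxDl !mxtraceD.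
by rewrite !mxtrace_form_tr; field.
Qed.

End Composite.
End CoefficientIdentities.

(** * The slack matrix and its semidefiniteness *)

Section SlackMatrix.
Variables (R : realType) (n : nat) (lam : 'M[R]_n.+1) (Rn xi : R) (k : 'I_n).
Hypothesis hi_k : hi k = ord_max.

Lemma trace_Smx d (p : 'cV[R]_d) (s : 'I_n -> 'cV[R]_d) :
  \tr (row_mx p (fam_mx s) *m Smx lam Rn xi *m (row_mx p (fam_mx s))^T)
  = Rn * dot p p + 2 * dot p (fam_mx s *m vcol lam)
    - \tr (fam_mx s *m lamhat lam *m (fam_mx s)^T)
    - Rn * (1 - xi) * dot (p + s k) (p + s k).
Proof.
rewrite /Smx; set e := (X in _ *: (X *m X^T)).
set V := row_mx p (fam_mx s); set S := fam_mx s.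
(* The two unit vectors in [e] select the first and last columns of [V]; by [hi_k] the last one is
   s_k. *)
have Ve : V *m e = p + s k.
  rewrite mulmxDr -!colE; congr (_ + _).
    by apply/matrixP => i j; rewrite ord1 mxE -[ord0](lshift0 n 0) row_mxEl.
  have -> : ord_max = rshift 1 k by rewrite -hi_k; apply: val_inj.
  by apply/matrixP => i j; rewrite ord1 mxE row_mxEr mxE.
rewrite mulmxBr mulmxBl linearB /= -scalemxAr -scalemxAl linearZ /=.
have -> : V *m (e *m e^T) *m V^T = (V *m e) *m (V *m e)^T.
  by rewrite trmx_mul !mulmxA.
rewrite Ve mxtrace_dot; congr (_ - _).
rewrite /V -/S mul_row_block tr_row_mx mul_row_col mxtraceD !mulmxDl !mxtraceD.
rewrite mulmxN mulNmx linearN /= mul_mx_scalar -scalemxAl linearZ /= !mxtrace_dot.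
have -> : \tr (p *m (vcol lam)^T *m S^T) = dot p (S *m vcol lam).
  by rewrite -mulmxA -trmx_mul mxtrace_dot.
by rewrite (dotC _ p); ring.
Qed.

Lemma psd_Smx : (forall i j, 0 <= lam i j) ->
  Rn = row_total lam ord_max + col_total lam ord_max ->
  Rn * (1 - xi) = vcol lam k 0 -> psd (Smx lam Rn xi).
Proof.
move=> lam_ge0 RnE xiE; split.
  rewrite /Smx linearB /= linearZ /= trmx_mul trmxK tr_block_mx tr_scalar_mx trmxK.
  by rewrite linearN /= lamhat_sym.
move=> u; pose p : 'cV[R]_1 := usubmx u.
pose s (i : 'I_n) : 'cV[R]_1 := row i (dsubmx u).
(* In dimension 1 the row u^T plays the role of V', so [trace_Smx] evaluates the form at u. *)
have -> : dot u (Smx lam Rn xi *m u) = \tr (u^T *m Smx lam Rn xi *m u).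
  by rewrite trace_mx11 -mulmxA.
have uE : u^T = row_mx p (fam_mx s).
  rewrite -{1}[u]vsubmxK tr_col_mx; congr row_mx.
    by apply/matrixP => i j; rewrite !ord1 mxE.
  by apply/matrixP => i j; rewrite !mxE ord1.
rewrite -{2}[u]trmxK uE trace_Smx xiE RnE.
(* The sign flip matches the cross term to that of the Laplacian and turns p + s_k into z_{n-1} -
   z_n. *)
pose z (i : 'I_n.+1) := if unlift ord_max i is Some j then s j else - p.
have z_lo i : z (lo i) = s i by rewrite lo_lift /z liftK.
have z_max : z ord_max = - p by rewrite /z unlift_none.
have := laplacian_form lam z.
rewrite (eq_fam_mx (b := s)) // z_max dotNr !(dotC (- p)) !dotNr opprK (dotC _ p).
rewrite mulrN opprK => <-.
have zE : dot (p + s k) (p + s k) = dot (z (lo k) - z ord_max) (z (lo k) - z ord_max).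
  by rewrite z_lo z_max opprK addrC.
have zE' : dot (p + s k) (p + s k) = dot (z ord_max - z (lo k)) (z ord_max - z (lo k)).
  by rewrite zE -opprB dotNr dotC dotNr opprK.
have lo_max : lo k != ord_max by rewrite lo_neq_max.
have F_ge0 i j : 0 <= lam i j * dot (z i - z j) (z i - z j).
  by rewrite mulr_ge0 ?dot_ge0.
(* The subtracted weight is that of the ordered pairs (n-1, n) and (n, n-1). Each is found in its
   own row of the double sum, and the remaining terms are nonnegative. *)
rewrite mxE mulrDl {1}zE zE' subr_ge0 [leRHS](bigD1 (lo k)) //=.
rewrite [X in _ <= _ + X](bigD1 ord_max) 1?eq_sym //= addrA ler_wpDr //.
  by rewrite sumr_ge0 // => i _; rewrite sumr_ge0.
rewrite lerD //; first by rewrite (bigD1 ord_max) //= lerDl sumr_ge0.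
by rewrite (bigD1 (lo k)) //= lerDl sumr_ge0.
Qed.

End SlackMatrix.

(** * Convex smooth functions and co-coercivity *)

Section Smooth.
Variables (R : realType) (d : nat).
Implicit Types (x y p : 'cV[R]_d) (f : 'cV[R]_d -> R).

Lemma derive_gradient f x p : differentiable f x -> 'D_p f x = dot (gradient f x) p.
Proof.
move=> df; rewrite dotE deriveE // {1}(matrix_sum_delta p) linear_sum.
apply: eq_bigr => i _; rewrite big_ord1 linearZ /= mxE deriveE //.
by rewrite mulrC.
Qed.

Lemma line_is_derive f y p (t : R) : differentiable f (y + t *: p) ->
  is_derive t (1 : R) (fun t : R => f (y + t *: p)) (dot (gradient f (y + t *: p)) p).
Proof.
move=> df.
have lineE : (fun h : R => h^-1 *: (((fun t : R => f (y + t *: p)) \o shift t) (h *: 1)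
    - f (y + t *: p)))
    = (fun h : R => h^-1 *: ((f \o shift (y + t *: p)) (h *: p) - f (y + t *: p))).
  apply/funext => h /=; congr (_ *: (f _ - _)).
  by rewrite [h *: 1]mulr1 scalerDl addrCA.
split; first by rewrite /derivable lineE; exact: diff_derivable.
by rewrite -derive_gradient // /derive lineE.
Qed.

Lemma cauchy_schwarz x y : dot x y <= enorm x * enorm y.
Proof.
apply: le_trans (ler_norm _) _.
rewrite -ler_sqr ?nnegrE ?mulr_ge0 ?sqrtr_ge0 // exprMn !enorm_sqr.
rewrite real_normK ?num_real //.
have [/eqP x0|x0] := eqVneq (dot x x) 0.
  have -> : x = 0.
    move: x0; rewrite dotE psumr_eq0 => [/allP x0|i _]; last by rewrite -expr2 sqr_ge0.
    apply/matrixP => i j; rewrite ord1 mxE; apply/eqP.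
    by have := x0 i (mem_index_enum _); rewrite mulf_eq0 orbb.
  by rewrite (dotC 0) !dot0r expr0n mul0r.
have x_gt0 : 0 < dot x x by rewrite lt_def x0 dot_ge0.
(* This is the component of y orthogonal to x, scaled by |x|^2 to avoid a division. *)
have := dot_ge0 (dot x x *: y - dot x y *: x).
rewrite dot_polarization !dotZl !dotZr (dotC y x) => ineq.
by rewrite -(ler_pM2l x_gt0); lra.
Qed.

(* Along a segment, the difference of the two sides has nonpositive derivative. *)
Lemma descent f x p : smooth 1 f ->
  f (x + p) <= f x + dot (gradient f x) p + 2^-1 * dot p p.
Proof.
move=> [df lip].
pose psi (t : R) := f (x + t *: p) - (t * dot (gradient f x) p + 2^-1 * dot p p * t ^+ 2).
have dpsi (t : R) : is_derive t (1 : R) psi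
    (dot (gradient f (x + t *: p)) p - (dot (gradient f x) p + dot p p * t)).
  have line := line_is_derive (df (x + t *: p)).
  apply: is_derive_eq.
  by rewrite /GRing.scale /=; field.
have : psi 1 <= psi 0.
  apply: (@ler0_derive1_le_cc _ psi 0 1).
  - by move=> t _; exact: ex_derive.
  - move=> t; rewrite in_itv /= => /andP[t0 _].
    rewrite derive1E derive_val subr_le0 -lerBlDl -dotBl.
    apply: le_trans (cauchy_schwarz _ _) _.
    have := lip (x + t *: p) x; rewrite mul1r addrAC subrr add0r => lipt.
    have -> : dot p p * t = enorm (t *: p) * enorm p.
      rewrite /enorm dotZl dotZr mulrA -expr2 sqrtrM ?sqr_ge0 // sqrtr_sqr.
      by rewrite gtr0_norm // -mulrA -expr2 -/(enorm p) enorm_sqr mulrC.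
    by rewrite ler_wpM2r ?sqrtr_ge0.
  - by apply: derivable_within_continuous => t _; exact: ex_derive.
  - by rewrite in_itv /= lexx ler01.
  - by rewrite in_itv /= lexx ler01.
  - exact: ler01.
rewrite /psi !scale1r scale0r addr0; lra.
Qed.

(** By convexity the difference quotients towards y with step h in (0, 1] are at most f(y) - f(x);
    the bound passes to the limit from the right. *)
Lemma convex_gradient_le f x y : convex_function setT f -> differentiable f x ->
  f x + dot (gradient f x) (y - x) <= f y.
Proof.
move=> cf df; rewrite -lerBrDl -derive_gradient //.
have /cvg_dnbhs_at_right lim_quot : (h^-1 *: ((f \o shift x) (h *: (y - x)) - f x)
    @[h --> 0^'] --> 'D_(y - x) f x)%classic by apply: diff_derivable.
apply: (cvgr_to_le lim_quot).
near=> h.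
have h0 : 0 < h by near: h; exact: nbhs_right_gt.
have h1 : h <= 1 by near: h; exact: nbhs_right_le.
rewrite /= /GRing.scale /= ler_pdivrMl //.
have h01 : Itv.spec (@Itv.num_sem R) (Itv.Real `[0%Z, 1%Z]) h.
  by rewrite /= /Itv.num_sem /= num_real in_itv /= ltW.
have cfh : f (h *: y + (1 - h) *: x) <= h * f y + (1 - h) * f x :=
  cf (Itv.mk h01) y x (in_setT _) (in_setT _).
have -> : h *: (y - x) + x = h *: y + (1 - h) *: x.
  by rewrite scalerBr scalerBl scale1r addrAC addrA.
apply: le_trans (lerB cfh (lexx _)) _.
by lra.
Unshelve. all: by end_near.
Qed.

(* The gradient lower bound at x, evaluated at the gradient step
   y - (grad f y - grad f x) of f - <grad f x, .>, against the descent lemma there. *)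
Lemma cocoercivity f x y : convex_function setT f -> smooth 1 f ->
  0 <= f y - f x - dot (gradient f x) (y - x)
       - 2^-1 * enorm (gradient f y - gradient f x) ^+ 2.
Proof.
move=> cf sf; set p := gradient f y - gradient f x.
have lower := convex_gradient_le (y - p) cf (sf.1 x).
have upper := descent y (- p) sf.
have dot_pp : dot p p = dot (gradient f y) p - dot (gradient f x) p by rewrite -dotBl.
clearbody p; move: lower upper; rewrite enorm_sqr !dotNr (dotC (- p)) dotNr opprK.
by rewrite !dotBr; lra.
Qed.

End Smooth.

(** * Assembly and the convergence rate *)

Theorem theorem2p8 (R : realType) (n : nat) (n_gt0 : (0 < n)%N)
    (H : 'M[R]_n) (lam : 'M[R]_n.+1) (Rn xi : R)
    (H_step : stepsize_matrix H)
    (lam_ge0 : forall i j, 0 <= lam i j)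
    (fom_identity : forall (d : nat) (fv : 'I_n.+1 -> R)
        (g x : 'I_n.+1 -> 'cV[R]_d),
      fom_iterates H g x ->
      \sum_i \sum_j lam i j * Qf fv g x i j
        = - (Rn / 2) * enorm (g ord_max) ^+ 2 + fv ord0 - fv ord_max) :
  [/\ (forall (d : nat) (fv hv : 'I_n.+1 -> R)
          (g s x : 'I_n.+1 -> 'cV[R]_d),
        composite_iterates H g s x ->
        \sum_i \sum_j lam i j * Qf fv g x i j
          + \sum_(i < n.+1) \sum_(j < n) mu H lam i j * Qh hv s x i (hi j)
          + 2^-1 * \tr (Vmx g s *m Smx lam Rn xi *m (Vmx g s)^T)
        = - (Rn * (1 - xi) / 2) * enorm (g ord_max + s ord_max) ^+ 2
          + (fv ord0 + hv ord0) - (fv ord_max + hv ord_max)),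
      (xi = 1 - (lam (inord n.-1) ord_max + lam ord_max (inord n.-1)) / Rn ->
        psd (Smx lam Rn xi))
    & ((forall i j, 0 <= mu H lam i j) -> psd (Smx lam Rn xi) -> xi < 1 ->
        forall (d : nat) (f : 'cV[R]_d -> R) (h : 'cV[R]_d -> \bar R)
          (x s : 'I_n.+1 -> 'cV[R]_d),
        convex_function setT f -> smooth 1 f -> proper_convex h ->
        (forall k : 'I_n, subgradient h (x (hi k)) (s (hi k))) ->
        composite_iterates H (fun i => gradient f (x i)) s x ->
        ((enorm (gradient f (x ord_max) + s ord_max) ^+ 2)%:E
          <= (2 / (Rn * (1 - xi)))%:E
             * (objective f h (x ord0) - objective f h (x ord_max)))%E)].
Proof.
have [k hi_k] : exists k : 'I_n, hi k = ord_max.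
  have k_lt : (n.-1 < n)%N by rewrite prednK.
  by exists (Ordinal k_lt); apply: val_inj; rewrite /= /bump /= add1n prednK.
have vcol_k : vcol lam k 0
    = lam (inord n.-1) ord_max + lam ord_max (inord n.-1).
  have -> : inord n.-1 = lo k.
    apply: val_inj; rewrite /= inordK ?ltnS ?leq_pred //.
    by have /(congr1 (predn \o val)) := hi_k; rewrite /= /bump.
  by rewrite mxE.
have RnE := RnE H_step fom_identity.
(* At index n the column total exceeds the row total by 1, since n differs from 0; hence R_n' is
   twice the row total plus 1. *)
have Rn_gt0 : 0 < Rn.
  have := total_diff fom_identity ord_max.
  have -> : (ord_max == ord0 :> 'I_n.+1) = false.
    by apply/negbTE; rewrite -val_eqE /= -lt0n.
  have row_ge0 : 0 <= row_total lam ord_max by rewrite sumr_ge0.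
  by rewrite RnE eqxx /=; lra.
have identity : forall (d : nat) (fv hv : 'I_n.+1 -> R)
    (g s x : 'I_n.+1 -> 'cV[R]_d),
  composite_iterates H g s x ->
  \sum_i \sum_j lam i j * Qf fv g x i j
    + \sum_(i < n.+1) \sum_(j < n) mu H lam i j * Qh hv s x i (hi j)
    + 2^-1 * \tr (Vmx g s *m Smx lam Rn xi *m (Vmx g s)^T)
  = - (Rn * (1 - xi) / 2) * enorm (g ord_max + s ord_max) ^+ 2
    + (fv ord0 + hv ord0) - (fv ord_max + hv ord_max).
  move=> d fv hv g s x x_iter.
  rewrite (composite_identity H_step fom_identity fv hv x_iter).
  rewrite /Vmx (trace_Smx _ _ _ hi_k (g ord_max) (s \o @hi n)) enorm_sqr /= hi_k.
  by field.
split => //.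
  move=> xiE; apply: (psd_Smx hi_k lam_ge0 RnE).
  by rewrite vcol_k xiE subKr mulrC divfK ?gt_eqF.
move=> mu_ge0 [_ S_ge0] xi_lt1 d f h x s cf sf [h_ninfty [y0 hy0] _] s_sub x_iter.
have c_gt0 : 0 < Rn * (1 - xi) by rewrite mulr_gt0 // subr_gt0.
(* A subgradient at a point where h is +oo would force h(y0) = +oo. *)
have h_fin (j : 'I_n) : h (x (hi j)) \is a fin_num.
  rewrite fin_numE h_ninfty /=; apply/eqP => hj.
  by have := s_sub j y0; rewrite hj /= leye_eq (negPf hy0).
have h_max_fin : h (x ord_max) \is a fin_num by rewrite -hi_k.
rewrite /objective -(fineK h_max_fin).
have [h0 | h0_fin] := eqVneq (h (x ord0)) +oo%E.
  by rewrite h0 /= gt0_muley ?leey // lte_fin divr_gt0.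
have h_all_fin i : h (x i) \is a fin_num.
  case: (unliftP ord0 i) => [j ->|->]; first exact: h_fin.
  by rewrite fin_numE h_ninfty h0_fin.
rewrite -(fineK (h_all_fin ord0)) /= lee_fin.
have := identity _ (f \o x) (fun i => fine (h (x i))) _ _ _ x_iter => /=.
set q := enorm _ ^+ 2; set tr := \tr _.
have tr_ge0 : 0 <= tr.
  (* The trace is the sum over the rows of V' of the form of S', one row per coordinate. *)
  rewrite /tr /mxtrace sumr_ge0 // => l _.
  have := S_ge0 (row l (Vmx (fun i => gradient f (x i)) s))^T.
  by rewrite /dot trmxK tr_row colE !mulmxA -colE -!row_mul mxE [X in 0 <= X]mxE.
have Qf_ge0 : 0 <= \sum_i \sum_j
    lam i j * Qf (f \o x) (fun i => gradient f (x i)) x i j.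
  apply: sumr_ge0 => i _; apply: sumr_ge0 => j _; rewrite mulr_ge0 //.
  exact: cocoercivity.
have Qh_ge0 : 0 <= \sum_(i < n.+1) \sum_(j < n)
    mu H lam i j * Qh (fun i => fine (h (x i))) s x i (hi j).
  apply: sumr_ge0 => i _; apply: sumr_ge0 => j _; rewrite mulr_ge0 //.
  have := s_sub j (x i).
  rewrite -(fineK (h_fin j)) -(fineK (h_all_fin i)) -EFinD lee_fin /Qh /=.
  by lra.
move=> total; have bound : Rn * (1 - xi) * q
    <= 2 * (f (x ord0) + fine (h (x ord0)) - (f (x ord_max) + fine (h (x ord_max)))).
  by lra.
by rewrite mulrAC ler_pdivlMr // mulrC.
Qed.
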